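(* Let $n\geq 1$, let $\varphi:L_n([0,1])\to L_n([0,1])$ be an $n$-dimensional automorphism, let $\mathcal{N}:L_n([0,1])\to L_n([0,1])$ be a function, and define $\mathcal{N}^{\varphi}(\mathbf{x})=\varphi^{-1}(\mathcal{N}(\varphi(\mathbf{x})))$ for all $\mathbf{x}\in L_n([0,1])$. Then: (a) $\mathcal{N}$ is an $n$-dimensional fuzzy negation if and only if $\mathcal{N}^{\varphi}$ is an $n$-dimensional fuzzy negation; (b) $\mathcal{N}$ is an $n$-dimensional strict fuzzy negation if and only if $\mathcal{N}^{\varphi}$ is an $n$-dimensional strict fuzzy negation; (c) $\mathcal{N}$ is an $n$-dimensional strong fuzzy negation if and only if $\mathcal{N}^{\varphi}$ is an $n$-dimensional strong fuzzy negation.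
   Context: $L_n([0,1])=\{(x_1,\ldots,x_n)\in[0,1]^n : x_1\leq\cdots\leq x_n\}$ with the componentwise order; $\mathbf{x}<\mathbf{y}$ means $\mathbf{x}\leq\mathbf{y}$ and $\mathbf{x}\neq\mathbf{y}$. For $x\in[0,1]$, $/x/=(x,\ldots,x)$. An $n$-dimensional automorphism is a bijection $\varphi:L_n([0,1])\to L_n([0,1])$ such that $\mathbf{x}\leq\mathbf{y}$ iff $\varphi(\mathbf{x})\leq\varphi(\mathbf{y})$. An $n$-dimensional fuzzy negation is a function $\mathcal{N}:L_n([0,1])\to L_n([0,1])$ with $\mathcal{N}(/0/)=/1/$, $\mathcal{N}(/1/)=/0/$ and $\mathcal{N}(\mathbf{x})\geq\mathcal{N}(\mathbf{y})$ whenever $\mathbf{x}\leq\mathbf{y}$. It is strong if $\mathcal{N}(\mathcal{N}(\mathbf{x}))=\mathbf{x}$ for all $\mathbf{x}$. It is strict if it is continuous and strictly decreasing, i.e. $\mathcal{N}(\mathbf{x})<\mathcal{N}(\mathbf{y})$ whenever $\mathbf{y}<\mathbf{x}$. Continuity of $F:L_n([0,1])\to L_n([0,1])$ means that the map $\sigma\circ F\circ\rho:[0,1]^n\to[0,1]^n$ is continuous in the usual sense, where $\rho:[0,1]^n\to L_n([0,1])$ sorts a tuple into increasing order and $\sigma:L_n([0,1])\to[0,1]^n$ is the inclusion. *)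

(* Defs.v *)
From HB Require Import structures.
From mathcomp Require Import all_boot all_order all_algebra.
From mathcomp Require Import all_classical all_reals all_analysis.
Set Implicit Arguments.
Unset Strict Implicit.
Unset Printing Implicit Defensive.
Import Order.TTheory GRing.Theory Num.Theory.
Import numFieldNormedType.Exports.

Local Open Scope classical_set_scope.
Local Open Scope ring_scope.

(* As a type, [cube R n] is the subtype of 'rV[R]_n with its induced
   topology, i.e. [0,1]^n with the usual topology. *)
Definition cube (R : realType) (n : nat) : set 'rV[R]_n :=
  [set u | forall i, 0 <= u ord0 i <= 1].

Definition incr_cube (R : realType) (n : nat) : set 'rV[R]_n :=
  [set u | cube u /\ forall i j : 'I_n, (i <= j)%N -> u ord0 i <= u ord0 j].

(* L_n([0,1]); only its order is used, never a topology of its own. *)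
Definition Ln (R : realType) (n : nat) : Type := set_type (@incr_cube R n).

HB.instance Definition _ (R : realType) (n : nat) :=
  Choice.copy (Ln R n) (set_type (@incr_cube R n)).

Definition coord (R : realType) (n : nat) (x : Ln R n) (i : 'I_n) : R :=
  val x ord0 i.

Section Order.
Variables (R : realType) (n : nat).
Implicit Types x y z : Ln R n.

Definition Ln_le x y : bool := [forall i, coord x i <= coord y i].

Lemma Ln_le_refl : reflexive Ln_le.
Proof. by move=> x; apply/forallP. Qed.

Lemma Ln_le_anti : antisymmetric Ln_le.
Proof.
move=> x y /andP[/forallP xy /forallP yx]; apply/val_inj/rowP => i.
by apply/le_anti/andP; split; [exact: xy|exact: yx].
Qed.

Lemma Ln_le_trans : transitive Ln_le.
Proof.
move=> y x z /forallP xy /forallP yz; apply/forallP => i.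
exact: le_trans (xy i) (yz i).
Qed.

End Order.

Fact Ln_display : Order.disp_t. Proof. exact: Order.Disp tt tt. Qed.

(* The induced strict order is [x < y] iff [x <= y] and [x != y]. *)
HB.instance Definition _ (R : realType) (n : nat) :=
  Order.Le_isPOrder.Build Ln_display (Ln R n)
    (@Ln_le_refl R n) (@Ln_le_anti R n) (@Ln_le_trans R n).

Lemma diag_subproof (R : realType) (n : nat) (x : R) :
  0 <= x <= 1 -> (const_mx x : 'rV[R]_n) \in @incr_cube R n.
Proof.
by move=> hx; apply/mem_set; split=> [i|i j _]; rewrite !mxE.
Qed.

(* The diagonal element /x/ = (x, ..., x). *)
Definition diag (R : realType) (n : nat) (x : R) (hx : 0 <= x <= 1) : Ln R n :=
  exist _ (const_mx x) (diag_subproof n hx).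

Definition diag0 (R : realType) (n : nat) : Ln R n :=
  diag n (introT andP (conj (lexx 0) ler01)).

Definition diag1 (R : realType) (n : nat) : Ln R n :=
  diag n (introT andP (conj ler01 (lexx 1))).

Definition sort_row (R : realType) (n : nat) (u : 'rV[R]_n) : 'rV[R]_n :=
  \row_(i < n) nth 0 (sort <=%R [seq u ord0 j | j <- enum 'I_n]) i.

Lemma sort_row_subproof (R : realType) (n : nat) (u : set_type (@cube R n)) :
  sort_row (val u) \in @incr_cube R n.
Proof.
have szs : size (sort <=%R [seq (val u) ord0 j | j <- enum 'I_n]) = n.
  by rewrite size_sort size_map size_enum_ord.
apply/mem_set; split=> [i|i j ij]; rewrite !mxE.
  have : nth 0 (sort <=%R [seq (val u) ord0 j | j <- enum 'I_n]) i
      \in sort <=%R [seq (val u) ord0 j | j <- enum 'I_n].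
    by rewrite mem_nth// szs.
  by rewrite mem_sort => /mapP[j _ ->]; exact: (set_mem (valP u)).
by apply: (sorted_leq_nth le_trans lexx) => //;
  rewrite ?inE ?szs//; exact: sort_le_sorted.
Qed.

Definition rho (R : realType) (n : nat) (u : set_type (@cube R n)) : Ln R n :=
  exist _ (sort_row (val u)) (sort_row_subproof u).

Lemma sigma_subproof (R : realType) (n : nat) (x : Ln R n) :
  val x \in @cube R n.
Proof. by apply/mem_set; case: (set_mem (valP x)). Qed.

Definition sigma (R : realType) (n : nat) (x : Ln R n) : set_type (@cube R n) :=
  exist _ (val x) (sigma_subproof x).

Definition Ln_continuous (R : realType) (n : nat) (F : Ln R n -> Ln R n) :
    Prop :=
  continuous (@sigma R n \o F \o @rho R n).

Local Open Scope order_scope.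

Definition automorphism (R : realType) (n : nat) (phi : Ln R n -> Ln R n) :
    Prop :=
  bijective phi /\ forall x y, x <= y <-> phi x <= phi y.

Definition fuzzy_negation (R : realType) (n : nat) (N : Ln R n -> Ln R n) :
    Prop :=
  [/\ N (diag0 R n) = diag1 R n,
      N (diag1 R n) = diag0 R n &
      forall x y, x <= y -> N y <= N x].

Definition strict_fuzzy_negation (R : realType) (n : nat)
    (N : Ln R n -> Ln R n) : Prop :=
  [/\ fuzzy_negation N, Ln_continuous N & forall x y, y < x -> N x < N y].

Definition strong_fuzzy_negation (R : realType) (n : nat)
    (N : Ln R n -> Ln R n) : Prop :=
  fuzzy_negation N /\ forall x, N (N x) = x.

(* N^phi = phi^-1 o N o phi, where [phiV] is the inverse of [phi]. *)
Definition conj_by (R : realType) (n : nat) (phi phiV : Ln R n -> Ln R n)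
    (N : Ln R n -> Ln R n) : Ln R n -> Ln R n :=
  fun x => phiV (N (phi x)).

(* Main.v *)
(* The substance is that an order automorphism of L_n([0,1]) is continuous. If
   x is within d of a, then x lies below the translate min(a + d, 1); these
   translates decrease to a as d tends to 0, and an automorphism preserves their
   infimum, which is computed coordinatewise. This bounds phi(x) from above, and
   the order-reversing involution x_i |-> 1 - x_(n+1-i) gives the lower bound.
   Since sorting is 1-Lipschitz for the sup norm and rho o sigma = id,
   continuity in the sense of sigma o F o rho is stable under composition. *)
Require Import Defs.
From mathcomp Require Import all_boot all_order all_algebra.
From mathcomp Require Import all_classical all_reals all_analysis.
From mathcomp Require Import lra.
(* Imported again so that [coord] is not the one of [vector]. *)
Import Defs.
Set Implicit Arguments.
Unset Strict Implicit.
Unset Printing Implicit Defensive.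
Import Order.TTheory GRing.Theory Num.Theory.
Import numFieldNormedType.Exports.
Local Open Scope classical_set_scope.
Local Open Scope ring_scope.

Section Ln_theory.
Variables (R : realType) (n : nat).
Implicit Types (x y a : Ln R n) (F G phi phiV : Ln R n -> Ln R n).

(** * Points of [L_n([0,1])] and their order *)

Lemma Ln_leP x y : reflect (forall i, coord x i <= coord y i) (x <= y)%O.
Proof. exact: forallP. Qed.

Lemma Ln_eqP x y : coord x =1 coord y -> x = y.
Proof. by move=> xy; apply/val_inj/rowP => i; exact: xy. Qed.

Lemma coord_itv x i : 0 <= coord x i <= 1.
Proof. by have [h _] := set_mem (valP x); exact: h. Qed.

Lemma coord_homo x (i j : 'I_n) : (i <= j)%N -> coord x i <= coord x j.
Proof. by have [_ h] := set_mem (valP x); exact: h. Qed.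

(** A [sig] rather than an [exists], so that [Ln_dual] can be defined by projecting the witness. *)
Lemma Ln_build (f : 'I_n -> R) :
  (forall i, 0 <= f i <= 1) -> (forall i j : 'I_n, (i <= j)%N -> f i <= f j) ->
  {x : Ln R n | coord x =1 f}.
Proof.
move=> f01 fle.
have h : \row_i f i \in @incr_cube R n.
  by apply/mem_set; split=> [i|i j ij]; rewrite !mxE; [exact: f01|exact: fle].
by exists (exist _ (\row_i f i) h) => i; rewrite /coord /= mxE.
Qed.

Lemma diag0_le x : (diag0 R n <= x)%O.
Proof.
by apply/Ln_leP => i; rewrite /coord mxE; have /andP[] := coord_itv x i.
Qed.

Lemma le_diag1 x : (x <= diag1 R n)%O.
Proof.
by apply/Ln_leP => i; rewrite [leRHS]mxE; have /andP[] := coord_itv x i.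
Qed.

(** * Sorting and continuity *)

(** Counting from 0, the i-th smallest entry is at most t exactly when more than i entries are at
    most t; an entry of [v] at most t gives one of [u] at most t + d at the same index. *)
Lemma sort_row_le (u v : 'rV[R]_n) (d : R) :
  (forall i, u ord0 i <= v ord0 i + d) ->
  forall i, sort_row u ord0 i <= sort_row v ord0 i + d.
Proof.
move=> uv i; rewrite !mxE.
apply: nth_count_le; first exact: sort_le_sorted.
set t := nth 0 _ _.
(* Otherwise at most i entries of [v] are at most [t], and the i-th sorted one, [t] itself, would
   exceed [t]. *)
have it : (i < count (<= t) (sort <=%R [seq v ord0 j | j <- enum 'I_n]))%N.
  rewrite ltnNge; apply/negP => h.
  have : t < t.
    apply: nth_count_gt; first exact: sort_le_sorted.
    by rewrite h size_sort size_map size_enum_ord ltn_ord.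
  by rewrite ltxx.
apply: leq_trans it _.
rewrite !(permP (permEl (perm_sort _ _))) !count_map.
by apply: sub_count => j /= vt; rewrite (le_trans (uv j))// lerD2r.
Qed.

Lemma sigmaK : cancel (@sigma R n) (@rho R n).
Proof.
move=> x; apply: Ln_eqP => i; rewrite /coord /= mxE sorted_sort.
- by rewrite (nth_map i) ?size_enum_ord// nth_ord_enum.
- exact: le_trans.
- apply: (homo_sorted (e := fun j k : 'I_n => (j <= k)%N)).
    by move=> j k jk; exact: coord_homo.
  by rewrite -(sorted_map (f := val)) val_enum_ord iota_sorted.
Qed.

Lemma ball_cubeP (u v : set_type (@cube R n)) (e : R) :
  ball u e v <-> 0 < e /\ forall i, `|val u ord0 i - val v ord0 i| < e.
Proof.
split=> [[e0 uv]|[e0 uv]]; split=> // i; first exact: uv.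
by move=> j; rewrite ord1; exact: uv.
Qed.

Lemma Ln_continuous_dist F :
  (forall a (e : R), 0 < e -> exists2 d : R, 0 < d & forall x,
    (forall i, `|coord a i - coord x i| <= d) ->
    forall i, `|coord (F a) i - coord (F x) i| < e) ->
  Ln_continuous F.
Proof.
move=> hF u A /nbhs_ballP[e /= e0 eA].
have [d d0 hd] := hF (rho u) e e0.
apply/nbhs_ballP; exists d => //= v /ball_cubeP[_ uv].
apply/eA/ball_cubeP; split=> // i; apply: hd => {}i.
rewrite ler_distlC; apply/andP; split.
- rewrite lerBlDr; apply: sort_row_le => j.
  by have := uv j; rewrite ltr_distl => /andP[_ /ltW].
- apply: sort_row_le => j.
  by have := uv j; rewrite distrC ltr_distl => /andP[_ /ltW].
Qed.

Lemma Ln_continuous_comp F G :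
  Ln_continuous F -> Ln_continuous G -> Ln_continuous (G \o F).
Proof.
move=> cF cG; rewrite /Ln_continuous.
have -> : @sigma R n \o (G \o F) \o @rho R n =
    (@sigma R n \o G \o @rho R n) \o (@sigma R n \o F \o @rho R n).
  by apply/funext => u /=; rewrite sigmaK.
by move=> u; apply: continuous_comp; [exact: cF|exact: cG].
Qed.

(** * Continuity of automorphisms *)

(** Complementing alone makes the tuple decreasing; reversing the indices makes it increasing
    again. *)
Definition Ln_dual x : Ln R n.
Proof.
apply: (sval (@Ln_build (fun i => 1 - coord x (rev_ord i)) _ _)).
- by move=> i; have := coord_itv x (rev_ord i); lra.
- by move=> i j ij; rewrite lerB// coord_homo//= leq_sub2l.
Defined.

Lemma coord_dual x i : coord (Ln_dual x) i = 1 - coord x (rev_ord i).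
Proof. by rewrite /Ln_dual; case: Ln_build. Qed.

Lemma Ln_dualK : involutive Ln_dual.
Proof.
by move=> x; apply: Ln_eqP => i; rewrite !coord_dual rev_ordK subKr.
Qed.

Lemma Ln_dual_le x y : (Ln_dual x <= Ln_dual y)%O = (y <= x)%O.
Proof.
apply/Ln_leP/Ln_leP => h i; last by rewrite !coord_dual lerB.
by have := h (rev_ord i); rewrite !coord_dual rev_ordK lerD2l lerN2.
Qed.

(* The coordinatewise infimum of [phi] over the upward translates of [a] lies
   in [L_n]; its preimage is below all these translates, hence below [a]. *)
Lemma automorphism_usc phi a (e : R) : automorphism phi -> 0 < e ->
  exists2 d : R, 0 < d & forall x, (forall i, coord x i <= coord a i + d) ->
    forall i, coord (phi x) i < coord (phi a) i + e.
Proof.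
move=> [[phiV phiK phiVK] phi_le] e0.
(* With the absolute value the translate lies in [L_n] for every real [d], so [choice] applies
   without a sign condition. *)
have /choice[up upE] : forall d : R, exists x : Ln R n,
    forall i, coord x i = Num.min (coord a i + `|d|) 1.
  move=> d.
  have [||x xE] := @Ln_build (fun i => Num.min (coord a i + `|d|) 1).
  - move=> i; have /andP[a0 _] := coord_itv a i.
    by rewrite le_min ler01 addr_ge0//= ge_min lexx orbT.
  - move=> i j ij; rewrite le_min ge_min lerD2r coord_homo//=.
    by rewrite ge_min lexx orbT.
  - by exists x.
pose E i := [set coord (phi (up d)) i | d in [set d : R | 0 < d]].
have E0 i : E i !=set0 by exists (coord (phi (up 1)) i), 1 => //=; exact: ltr01.
have lbE i : lbound (E i) 0.
  by move=> _ [d _ <-]; have /andP[] := coord_itv (phi (up d)) i.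
have infE i : has_inf (E i) by split; [exact: E0|exists 0; exact: lbE].
have inf_le i d : 0 < d -> inf (E i) <= coord (phi (up d)) i.
  by move=> d0; apply: ge_inf; [exists 0; exact: lbE|exists d].
have [||g gE] := @Ln_build (fun i => inf (E i)).
- move=> i; apply/andP; split; first exact: lb_le_inf.
  have /andP[_ h] := coord_itv (phi (up 1)) i.
  by apply: le_trans h; exact: inf_le.
- move=> i j ij; apply: lb_le_inf => // _ [d /= d0 <-].
  by apply: le_trans (coord_homo _ ij); exact: inf_le.
have ga : (g <= phi a)%O.
  rewrite -[g]phiVK; apply/(phi_le _ _).1/Ln_leP => i; apply/ler_addgt0Pr => d d0.
  have /Ln_leP/(_ i) : (phiV g <= up d)%O.
    by apply/phi_le; rewrite phiVK; apply/Ln_leP => j; rewrite gE; exact: inf_le.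
  by rewrite upE le_min gtr0_norm// => /andP[].
(* Since [inf (E i)] is at most [coord (phi a) i], some element of [E i] is within [e] of it; [d]
   depends on the coordinate. *)
have /choice[d dP] : forall i, exists d : R,
    0 < d /\ coord (phi (up d)) i < coord (phi a) i + e.
  move=> i; have [_ [d /= d0 <-] h] := inf_adherent e0 (infE i).
  exists d; split=> //; apply: lt_le_trans h _.
  by rewrite lerD2r -gE; exact: (Ln_leP _ _ ga).
(* The minimum over finitely many coordinates serves them all; the default 1 is positive too. *)
exists (\big[Order.min/1]_i d i).
  by apply: lt_bigmin => [|i _]; [exact: ltr01|have [] := dP i].
move=> x xa i; have [di0 hi] := dP i.
apply: le_lt_trans hi; apply: (Ln_leP _ _ _ i); apply/(phi_le _ _).1/Ln_leP => j.
rewrite upE le_min; have /andP[_ ->] := coord_itv x j; rewrite andbT.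
by apply: le_trans (xa j) _; rewrite lerD2l gtr0_norm//; exact: bigmin_le_cond.
Qed.

Lemma automorphism_dual phi :
  automorphism phi -> automorphism (Ln_dual \o phi \o Ln_dual).
Proof.
move=> [[phiV phiK phiVK] phi_le]; split.
  exists (Ln_dual \o phiV \o Ln_dual) => x /=.
    by rewrite Ln_dualK phiK Ln_dualK.
  by rewrite Ln_dualK phiVK Ln_dualK.
by move=> x y /=; rewrite Ln_dual_le -phi_le Ln_dual_le.
Qed.

(** The upper bound for the conjugate of [phi] by [Ln_dual], taken at the dual of [a], is the lower
    bound for [phi] at [a]. *)
Lemma automorphism_lsc phi a (e : R) : automorphism phi -> 0 < e ->
  exists2 d : R, 0 < d & forall x, (forall i, coord a i <= coord x i + d) ->
    forall i, coord (phi a) i < coord (phi x) i + e.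
Proof.
move=> /automorphism_dual phiD e0.
have [d d0 hd] := automorphism_usc (Ln_dual a) phiD e0.
exists d => // x xa i.
have := hd (Ln_dual x) _ (rev_ord i).
rewrite /= !Ln_dualK !coord_dual rev_ordK => h.
suff : 1 - coord (phi x) i < 1 - coord (phi a) i + e by lra.
by apply: h => j; rewrite !coord_dual; have := xa (rev_ord j); lra.
Qed.

Lemma automorphism_continuous phi : automorphism phi -> Ln_continuous phi.
Proof.
move=> phiA; apply: Ln_continuous_dist => a e e0.
have [d d0 hd] := automorphism_usc a phiA e0.
have [d' d'0 hd'] := automorphism_lsc a phiA e0.
exists (Num.min d d'); first by rewrite lt_min d0.
move=> x xa i; rewrite ltr_distlC; apply/andP; split.
- rewrite ltrBlDr; apply: hd' => j.
  have := xa j; rewrite le_min => /andP[_].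
  by rewrite ler_distlC lerBlDr => /andP[].
- apply: hd => j.
  by have := xa j; rewrite le_min => /andP[+ _]; rewrite ler_distlC => /andP[].
Qed.

(** * Inverses, strict order and extreme points *)

Lemma automorphism_inv phi phiV : cancel phi phiV -> cancel phiV phi ->
  automorphism phi -> automorphism phiV.
Proof.
move=> phiK phiVK [_ phi_le]; split; first by exists phi.
by move=> x y; rewrite (phi_le (phiV x)) !phiVK.
Qed.

Lemma automorphism_lt phi x y :
  automorphism phi -> (x < y)%O -> (phi x < phi y)%O.
Proof.
move=> [phi_bij phi_le]; rewrite !lt_neqAle => /andP[xy /phi_le ->].
by rewrite (inj_eq (bij_inj phi_bij)) xy.
Qed.

(** The least element lies below its own preimage, so its image lies below it. *)
Lemma automorphism_diag0 phi : automorphism phi -> phi (diag0 R n) = diag0 R n.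
Proof.
move=> [[phiV phiK phiVK] phi_le]; apply/le_anti; rewrite diag0_le andbT.
by rewrite -[leRHS]phiVK; exact/(phi_le _ _).1/diag0_le.
Qed.

Lemma automorphism_diag1 phi : automorphism phi -> phi (diag1 R n) = diag1 R n.
Proof.
move=> [[phiV phiK phiVK] phi_le]; apply/le_anti; rewrite le_diag1/=.
by rewrite -[leLHS]phiVK; exact/(phi_le _ _).1/le_diag1.
Qed.

(** * Conjugation of negations *)

Section conjugation.
Variables phi phiV : Ln R n -> Ln R n.
Hypotheses (phiK : cancel phi phiV) (phiVK : cancel phiV phi).
Hypothesis phiA : automorphism phi.
Variable N : Ln R n -> Ln R n.

Let phiVA : automorphism phiV := automorphism_inv phiK phiVK phiA.

(** With [phi] and [phiV] exchanged, this turns each direct implication below into its converse. *)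
Lemma conj_byK : conj_by phiV phi (conj_by phi phiV N) = N.
Proof. by apply/funext => x; rewrite /conj_by !phiVK. Qed.

Lemma fuzzy_negation_conj :
  fuzzy_negation N -> fuzzy_negation (conj_by phi phiV N).
Proof.
move=> [N0 N1 Nle]; split; rewrite /conj_by.
- by rewrite automorphism_diag0// N0 automorphism_diag1.
- by rewrite automorphism_diag1// N1 automorphism_diag0.
- by move=> x y /phiA.2/Nle/phiVA.2.
Qed.

Lemma strict_fuzzy_negation_conj :
  strict_fuzzy_negation N -> strict_fuzzy_negation (conj_by phi phiV N).
Proof.
move=> [/fuzzy_negation_conj Nf Nc Nlt]; split=> //.
  (* Both [phi] and [phiV] are automorphisms, hence continuous. *)
  apply: (@Ln_continuous_comp (N \o phi) phiV).
    by apply: Ln_continuous_comp => //; exact: automorphism_continuous.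
  exact: automorphism_continuous.
by move=> x y yx; apply/(automorphism_lt phiVA)/Nlt/automorphism_lt.
Qed.

Lemma strong_fuzzy_negation_conj :
  strong_fuzzy_negation N -> strong_fuzzy_negation (conj_by phi phiV N).
Proof.
move=> [/fuzzy_negation_conj Nf NN]; split=> // x.
by rewrite /conj_by phiVK NN phiK.
Qed.

End conjugation.
End Ln_theory.

Theorem proposition33 (R : realType) (n : nat) (hn : (1 <= n)%N)
    (phi phiV : Ln R n -> Ln R n) (hphi : automorphism phi)
    (phiK : cancel phi phiV) (phiVK : cancel phiV phi)
    (N : Ln R n -> Ln R n) :
  (fuzzy_negation N <-> fuzzy_negation (conj_by phi phiV N)) /\
  (strict_fuzzy_negation N <-> strict_fuzzy_negation (conj_by phi phiV N)) /\
  (strong_fuzzy_negation N <-> strong_fuzzy_negation (conj_by phi phiV N)).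
Proof.
have phiVA := automorphism_inv phiK phiVK hphi.
have NE := conj_byK phiVK N.
split; [|split]; split.
- exact: fuzzy_negation_conj.
- by move=> /(fuzzy_negation_conj phiVK phiK phiVA); rewrite NE.
- exact: strict_fuzzy_negation_conj.
- by move=> /(strict_fuzzy_negation_conj phiVK phiK phiVA); rewrite NE.
- exact: strong_fuzzy_negation_conj.
- by move=> /(strong_fuzzy_negation_conj phiVK phiK phiVA); rewrite NE.
Qed.
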